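(* Let $G$ be a connected signed graph on the vertex set $[n+1]$, let $\mathbf{a}=(a_1,\ldots,a_{n+1})\in\mathbb{Z}^{n+1}$, and let $\mathcal{F}_G(\mathbf{a})$ be its flow polytope. Assume that for a fixed $i\in[n+1]$ we have $a_i=0$ and $G$ has no loops incident to vertex $i$. Fix linear orders $\theta_{\mathcal{I}}$ and $\theta_{\mathcal{O}}$ on the multisets $\mathcal{I}_i(G)$ and $\mathcal{O}_i(G)$ of incoming and outgoing edges at $i$, and let $L$ and $R$ be the resulting ordered sets and $R^+\subseteq R$ the ordered set of positive edges in $R$. Then the flow polytope $\mathcal{F}_G(\mathbf{a})$ subdivides as $$\mathcal{F}_G(\mathbf{a})=\bigcup_{T\in\mathcal{T}^{\pm}_{L,R}(R^+)}\mathcal{F}_{G_T^{(i)}}(a_1,\ldots,a_{i-1},\widehat{a_i},a_{i+1},\ldots,a_{n+1}),$$ where $\widehat{a_i}$ means that the entry $a_i$ is omitted.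
   Context: Signed graphs: finite graphs on $[n+1]=\{1,\ldots,n+1\}$, loops and multiple edges allowed, each edge carrying a sign. An edge between $r<s$ is written $(r,s,-)$ or $(r,s,+)$; loops are positive, written $(r,r,+)$. For a positive edge the order of its endpoints is irrelevant. To an edge associate the vector $\mathbf{e}_r-\mathbf{e}_s$ for $(r,s,-)$, and $\mathbf{e}_r+\mathbf{e}_s$ for $(r,s,+)$ (so $2\mathbf{e}_r$ for a loop). $M_G$ is the matrix with these vectors as columns and $\mathcal{F}_G(\mathbf{a})=\{f\in\mathbb{R}^{E(G)}_{\ge0}: M_Gf=\mathbf{a}\}$. The same definitions are used for signed graphs on the vertex set $[n+1]\setminus\{i\}$. Incoming/outgoing edges: $\mathcal{I}_i(G)$ is the multiset of negative edges $(r,i,-)$, $r<i$. $\mathcal{O}_i(G)$ is the multiset of edges $(i,s,\pm)$, $s>i$, together with the edges $(t,i,+)$, $t<i$. Trees: for ordered sets $L=(x_1,\ldots,x_\ell)$ and $R=(x_{\ell+1},\ldots,x_{\ell+r})$ and $R^+\subseteq R$, $\mathcal{T}^{\pm}_{L,R}(R^+)$ is the set of trees $T$ on vertex set $L\sqcup R$, bipartite with parts $L,R$ (every edge joins $L$ to $R$), that are noncrossing: there is no pair of edges $(x_p,x_{\ell+q})$, $(x_t,x_{\ell+u})$ with $p<t$ and $q>u$. The edges of $T$ carry signs: those at right vertices in $R^+$ are positive and all others are negative. If $L$ or $R$ is empty, $\mathcal{T}^{\pm}_{L,R}(R^+)$ consists of one element, the empty tree (no edges). The graph $G_T^{(i)}$: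 for a tree edge $(e_1,e_2)$ of $T$ with $e_1=(r,i,-)\in\mathcal{I}_i(G)$ and $e_2\in\mathcal{O}_i(G)$, let $edge(e_1,e_2)$ be $(r,s,\pm)$ if $e_2=(i,s,\pm)$; and the positive edge between $r$ and $t$ (a loop $(r,r,+)$ if $r=t$) if $e_2=(t,i,+)$. Its associated vector is the sum of those of $e_1$ and $e_2$. $G_T^{(i)}$ is the signed graph on $[n+1]\setminus\{i\}$ obtained from $G$ by deleting vertex $i$ and all edges incident to it, and adding the multiset of edges $\{\{edge(e_1,e_2):(e_1,e_2)\in E(T)\}\}$. Identification: $\mathcal{F}_{G_T^{(i)}}(\mathbf{a}')$, where $\mathbf{a}'$ is $\mathbf{a}$ with $a_i$ omitted, is regarded as a subset of $\mathcal{F}_G(\mathbf{a})$ via the injective linear map sending a flow $g$ on $G_T^{(i)}$ to the flow $f$ on $G$ with $f(e)=g(e)$ for $e$ not incident to $i$; $f(e_1)=\sum_{e_2:(e_1,e_2)\in E(T)}g(edge(e_1,e_2))$ for $e_1\in\mathcal{I}_i(G)$; and $f(e_2)=\sum_{e_1:(e_1,e_2)\in E(T)}g(edge(e_1,e_2))$ for $e_2\in\mathcal{O}_i(G)$. ''Subdivides as'' means that the polytope is the displayed union and that any two of the pieces intersect in a common (possibly empty, possibly improper) face of both. *)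

(* Defs.v *)
From HB Require Import structures.
From mathcomp Require Import all_boot all_order all_algebra.
From mathcomp Require Import boolp classical_sets reals.

Set Implicit Arguments.
Unset Strict Implicit.
Unset Printing Implicit Defensive.

Import Order.TTheory GRing.Theory Num.Theory.
Local Open Scope ring_scope.

(* Signed graphs on a vertex set V contained in {0, ..., N-1}. The vertices
   keep their names when V shrinks, so deleting i from V = [set: 'I_N] gives a
   graph on V = [set~ i].
   Edges are indexed by a finite type, which allows multiple edges. An edge is
   stored with its smaller endpoint sg_lo first; this fixes the representation
   of positive edges, for which the order of the endpoints is irrelevant. *)
Record signed_graph (N : nat) (V : {set 'I_N}) := SignedGraph {
  sg_edge : finType;
  sg_lo : sg_edge -> 'I_N;
  sg_hi : sg_edge -> 'I_N;
  sg_pos : sg_edge -> bool;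
  sg_lo_in : forall e, sg_lo e \in V;
  sg_hi_in : forall e, sg_hi e \in V;
  sg_le : forall e,
    if sg_pos e then (sg_lo e <= sg_hi e)%N else (sg_lo e < sg_hi e)%N
}.

Section SignedGraph.
Variables (N : nat) (V : {set 'I_N}) (G : signed_graph V).

Definition sg_adj : rel 'I_N := fun u v =>
  [exists e : sg_edge G, ((sg_lo e == u) && (sg_hi e == v))
                      || ((sg_lo e == v) && (sg_hi e == u))].

Definition sg_connected : Prop := {in V &, forall u v, connect sg_adj u v}.

Definition incident (i : 'I_N) (e : sg_edge G) : bool :=
  (sg_lo e == i) || (sg_hi e == i).

Definition is_loop (e : sg_edge G) : bool := sg_lo e == sg_hi e.

Definition incoming (i : 'I_N) : {set sg_edge G} :=
  [set e | ~~ sg_pos e & sg_hi e == i].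

Definition outgoing (i : 'I_N) : {set sg_edge G} :=
  [set e | ((sg_lo e == i) && (i < sg_hi e)%N)
        || [&& sg_pos e, sg_hi e == i & (sg_lo e < i)%N]].

Variable R : realType.

Definition edge_vec (e : sg_edge G) : 'cV[R]_N :=
  if sg_pos e then delta_mx (sg_lo e) 0 + delta_mx (sg_hi e) 0
  else delta_mx (sg_lo e) 0 - delta_mx (sg_hi e) 0.

(* The product M_G f, as the linear combination of the columns of M_G with
   coefficients f. *)
Definition netflow (f : {ffun sg_edge G -> R}) : 'cV[R]_N :=
  \sum_e f e *: edge_vec e.

(* Only the entries of a at vertices in V are used: for V = [set~ i], the
   entry of a at i is omitted. *)
Definition flow_polytope (a : 'cV[int]_N) : set {ffun sg_edge G -> R} :=
  [set f : {ffun sg_edge G -> R} | (forall e, 0 <= f e)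
        /\ (forall v, v \in V -> netflow f v 0 = (a v 0)%:~R)]%classic.

End SignedGraph.

Arguments flow_polytope {N V} G R a.

Section Trees.

(* The graph with vertex set A and adjacency relation e is a tree: it is
   nonempty, connected, and has no cycle. *)
Definition is_tree (W : finType) (A : pred W) (e : rel W) : Prop :=
  [/\ forall u v, e u v -> A u /\ A v,
      exists u, A u,
      forall u v, A u -> A v -> connect e u v
    & forall c : seq W, (2 < size c)%N -> ~ ucycle e c].

Variables (X Y : finType).

(* A signed bipartite graph is a set of triples (x, y, s): an edge joining the
   left vertex x to the right vertex y, of sign s, where true is positive.
   The disjoint union of the two vertex sets is taken inside X + Y. *)
Definition bip_adj (T : {set X * Y * bool}) : rel (X + Y)%type := fun u v =>
  match u, v with
  | inl x, inr y | inr y, inl x => [exists s, (x, y, s) \in T]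
  | _, _ => false
  end.

Definition bip_vertices (L : seq X) (R : seq Y) : pred (X + Y)%type := fun u =>
  match u with inl x => x \in L | inr y => y \in R end.

Definition noncrossing (L : seq X) (R : seq Y) (T : {set X * Y * bool}) : Prop :=
  forall t u, t \in T -> u \in T ->
  ~ ((index t.1.1 L < index u.1.1 L)%N /\ (index u.1.2 R < index t.1.2 R)%N).

Definition is_nctree (L : seq X) (R Rplus : seq Y) (T : {set X * Y * bool}) : Prop :=
  if nilp L || nilp R then T = finset.set0
  else [/\ forall t, t \in T -> t.1.1 \in L /\ t.1.2 \in R,
           is_tree (bip_vertices L R) (bip_adj T),
           noncrossing L R T
         & forall t, t \in T -> t.2 = (t.1.2 \in Rplus)].

Record nctree (L : seq X) (R Rplus : seq Y) := NCTree {
  nct_edges : {set X * Y * bool};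
  nct_edgesP : is_nctree L R Rplus nct_edges
}.

Lemma nctree_in L R Rplus (T : nctree L R Rplus) t :
  t \in nct_edges T -> t.1.1 \in L /\ t.1.2 \in R.
Proof.
case: T => T /= HT; move: HT; rewrite /is_nctree.
by case: ifP => [_ ->|_ [H _ _ _]]; [rewrite finset.in_set0 | exact: H].
Qed.

End Trees.

Definition linear_order_on (X : finType) (A : {set X}) (theta : rel X) : Prop :=
  [/\ {in A, reflexive theta}, {in A &, antisymmetric theta},
      {in A & &, transitive theta} & {in A &, total theta}].

Definition ordered_set (X : finType) (theta : rel X) (A : {set X}) : seq X :=
  sort theta (enum A).

Section Reduction.
Variables (N : nat) (G : signed_graph [set: 'I_N]) (i : 'I_N).
Variables (thetaI thetaO : rel (sg_edge G)).

Definition left_set := ordered_set thetaI (incoming G i).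
Definition right_set := ordered_set thetaO (outgoing G i).
Definition right_pos := [seq e <- right_set | sg_pos e].

Definition reduction_tree := nctree left_set right_set right_pos.

(* The endpoints, in increasing order, of edge(e1, e2); its sign is that
   of e2. *)
Definition merged_ends (e1 e2 : sg_edge G) : 'I_N * 'I_N :=
  let r := sg_lo e1 in
  if sg_lo e2 == i then (r, sg_hi e2)
  else let t := sg_lo e2 in if (r <= t)%N then (r, t) else (t, r).

Variable T : reduction_tree.

(* The edges not incident to i, and one edge for each edge of T. *)
Definition red_edge : finType :=
  ({e : sg_edge G | ~~ incident i e} + {t | t \in nct_edges T})%type.

Definition red_lo (d : red_edge) : 'I_N :=
  match d with
  | inl e => sg_lo (val e)
  | inr t => (merged_ends (val t).1.1 (val t).1.2).1
  end.

Definition red_hi (d : red_edge) : 'I_N :=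
  match d with
  | inl e => sg_hi (val e)
  | inr t => (merged_ends (val t).1.1 (val t).1.2).2
  end.

Definition red_pos (d : red_edge) : bool :=
  match d with
  | inl e => sg_pos (val e)
  | inr t => sg_pos (val t).1.2
  end.

Lemma tree_edge_in (t : {t | t \in nct_edges T}) :
  (val t).1.1 \in incoming G i /\ (val t).1.2 \in outgoing G i.
Proof.
have [] := nctree_in (valP t).
by rewrite !mem_sort !mem_enum.
Qed.

Lemma incoming_lt (e : sg_edge G) : e \in incoming G i -> (sg_lo e < i)%N.
Proof.
rewrite inE => /andP[/negbTE e_neg /eqP <-].
by have := sg_le e; rewrite e_neg.
Qed.

Lemma red_ends (d : red_edge) :
  [/\ red_lo d != i, red_hi d != i &
      if red_pos d then (red_lo d <= red_hi d)%N else (red_lo d < red_hi d)%N].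
Proof.
case: d => [[e e_i]|t] /=.
  by move: e_i; rewrite negb_or => /andP[-> ->]; split=> //; exact: sg_le.
have [/incoming_lt r_i] := tree_edge_in t.
have r_neq : sg_lo (val t).1.1 != i by rewrite -val_eqE neq_ltn r_i.
rewrite /merged_ends inE => /orP[/andP[lo_i i_s]|/and3P[e2_pos _ t_i]].
  rewrite lo_i /= r_neq -val_eqE neq_ltn i_s orbT.
  have r_s := ltn_trans r_i i_s; split=> //.
  by case: ifP => // _; exact: ltnW.
have t_neq : sg_lo (val t).1.2 != i by rewrite -val_eqE neq_ltn t_i.
rewrite (negbTE t_neq) e2_pos; case: leqP => [le_rt|lt_tr] /=; split=> //.
exact: ltnW.
Qed.

Lemma red_lo_in (d : red_edge) : red_lo d \in [set~ i].
Proof. by rewrite !inE; have [] := red_ends d. Qed.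

Lemma red_hi_in (d : red_edge) : red_hi d \in [set~ i].
Proof. by rewrite !inE; have [] := red_ends d. Qed.

Lemma red_le (d : red_edge) :
  if red_pos d then (red_lo d <= red_hi d)%N else (red_lo d < red_hi d)%N.
Proof. by have [] := red_ends d. Qed.

Definition reduced_graph : signed_graph [set~ i] :=
  SignedGraph red_lo_in red_hi_in red_le.

Variable R : realType.

Definition flow_lift (g : {ffun sg_edge reduced_graph -> R}) :
    {ffun sg_edge G -> R} :=
  [ffun e =>
    if insub e is Some e' then g (inl e')
    else if e \in incoming G i then
      \sum_(t : {t | t \in nct_edges T} | (val t).1.1 == e) g (inr t)
    else \sum_(t : {t | t \in nct_edges T} | (val t).1.2 == e) g (inr t)].

(* The flow polytope of the reduced graph, as a subset of the flow space
   of G. *)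
Definition reduced_polytope (a : 'cV[int]_N) : set {ffun sg_edge G -> R} :=
  [set flow_lift g | g in flow_polytope reduced_graph R a]%classic.

End Reduction.

Arguments reduced_polytope {N G i thetaI thetaO} T R a.

Section Subdivision.
Variables (R : realType) (E : finType).

(* The empty set and P itself are faces (take c = 0 and b = 1, resp. b = 0). *)
Definition is_face (F P : set {ffun E -> R}) : Prop :=
  exists (c : {ffun E -> R}) (b : R),
    (forall x, P x -> \sum_e c e * x e <= b)
    /\ F = [set x | P x /\ \sum_e c e * x e = b]%classic.

Definition subdivides_as (J : Type) (P : set {ffun E -> R})
    (piece : J -> set {ffun E -> R}) : Prop :=
  P = (\bigcup_j piece j)%classic
  /\ forall j k, is_face (piece j `&` piece k)%classic (piece j)
              /\ is_face (piece j `&` piece k)%classic (piece k).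

End Subdivision.

(* Main.v *)
Require Import Defs.
From mathcomp Require Import all_boot all_order all_algebra.
From mathcomp Require Import boolp classical_sets reals.
From mathcomp Require Import zify.
Import Order.TTheory GRing.Theory Num.Theory.
Local Open Scope ring_scope.

(** Near the vertex [i], a flow [f] only sees the amounts [f e1] carried by the
incoming edges and the amounts [f e2] carried by the outgoing edges, and since
[a i 0 = 0] these have the same total. The map from flows on the reduced graph
to flows on [G] preserves the netflow, because the vector of [edge(e1, e2)] is
the sum of the vectors of [e1] and [e2]. Hence [f] lies in the piece of a tree
[T] exactly when it lies in the flow polytope of [G] and its values at [i] are
the marginals of some nonnegative weights on the edges of [T]
([reduced_polytopeP]). Everything then reduces to transportation plans with a
noncrossing support.

The pieces cover: the northwest corner rule turns two nonnegative vectors with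
the same total into a noncrossing tree with weights having these marginals
([northwest_corner_tree]). It matches the first left vertex with the first right
vertex by the smaller of the two remaining amounts, discards a vertex that is
used up, and goes on; read backwards, each step adds a leaf in front of a
noncrossing tree, so the result is again a noncrossing tree.

The pieces meet in faces: nonnegative weights with a noncrossing support are
determined by their marginals ([nc_weighting_unique]), since in the matrix of
weights, with rows for the left and columns for the right vertices, the total
over a northwest corner is the smaller of the totals over its rows and over its
columns ([corner_sum]). So a flow in the pieces of [T] and [U] gets the same weights
from both, and the intersection is the part of the piece of [T] where all
weights on the edges of [T] outside [U] vanish. It remains to express the total
of these weights as a linear functional of [f]: uniqueness makes the map from
weights on [T] to marginals injective, so it has a linear left inverse
([tree_potential]). *)

Set Implicit Arguments.
Unset Strict Implicit.

(** * Adding a leaf to a tree *)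

Section TreeLeaf.
Variables (W : finType) (A : pred W) (e : rel W) (a z : W).

(** A cycle of length at least 3 through the new vertex [z] would have to enter
and leave it through its only neighbour [a], so [a] would occur twice. *)
Lemma is_tree_leaf (A' : pred W) (e' : rel W) :
  is_tree A e -> A a -> ~~ A z ->
  (forall u, A' u = (u == z) || A u) ->
  (forall u v, e' u v = [|| e u v, (u == z) && (v == a) | (u == a) && (v == z)]) ->
  is_tree A' e'.
Proof.
move=> [eA [u0 Au0] conn acyc] Aa Az A'E e'E.
have ez u : (e u z = false) * (e z u = false).
  by split; apply/negP => /eA[H1 H2]; move: Az; rewrite ?H1 ?H2.
have sube u v : e u v -> connect e' u v.
  by move=> euv; apply: connect1; rewrite e'E euv.
have az : connect e' a z by apply: connect1; rewrite e'E !eqxx !orbT.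
have za : connect e' z a by apply: connect1; rewrite e'E !eqxx !orbT.
have toA u : A' u -> connect e' u a /\ connect e' a u.
  rewrite A'E => /orP[/eqP->//|Au].
  by split; apply: (connect_sub sube); apply: conn.
split.
- move=> u v; rewrite e'E !A'E => /or3P[/eA[-> ->]|/andP[/eqP-> /eqP->]|/andP[/eqP-> /eqP->]];
    by rewrite ?eqxx ?Aa ?orbT.
- by exists u0; rewrite A'E Au0 orbT.
- move=> u v /toA[ua _] /toA[_ av]; exact: connect_trans ua av.
- move=> c c2 /andP[cyc uc].
  have zN v : e' z v = (v == a).
    rewrite e'E (ez v) /= eqxx /=; case: eqVneq => //= _.
    by apply/negbTE/negP => /andP[/eqP za' _]; move: Az; rewrite za' Aa.
  have Nz v : e' v z = (v == a).
    rewrite e'E (ez v) /= eqxx andbT; case: (v == a); rewrite ?orbT ?orbF //.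
    apply/negbTE/negP => /andP[_ /eqP za']; move: Az; by rewrite za' Aa.
  have [zc|zNc] := boolP (z \in c); last first.
    apply: (acyc c c2); rewrite /ucycle uc andbT.
    apply: (sub_in_cycle (P := mem c) _ _ cyc); last exact/allP.
    move=> u v /= uc' vc'; rewrite e'E.
    have -> : (u == z) = false by apply/eqP => uz; rewrite -uz uc' in zNc.
    have -> : (v == z) = false by apply/eqP => vz; rewrite -vz vc' in zNc.
    by rewrite andbF !orbF.
  (* The cycle is rotated so as to start at z. *)
  have [k c' rc] := rot_to zc.
  move: cyc uc c2; rewrite -(rot_cycle k) -(rot_uniq k) -(size_rot k) rc.
  case: c' {rc} => [|b c'] //; case/lastP: c' => [|c' d] //.
  rewrite /= rcons_path last_rcons => /andP[zb /andP[_ dz]].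
  move: zb dz; rewrite zN Nz => /eqP-> /eqP->.
  by rewrite mem_rcons inE eqxx /= andbF.
Qed.

End TreeLeaf.

(** * Noncrossing trees obtained by putting a vertex in front *)

Section Trees.
Variables (X Y : finType).
Implicit Types (L : seq X) (Q Rplus : seq Y) (T : {set X * Y * bool}).

Lemma bip_adj1 T x y (s : bool) u v :
  bip_adj ((x, y, s) |: T) u v =
  [|| bip_adj T u v, (u == inl x) && (v == inr y) | (u == inr y) && (v == inl x)].
Proof.
have aux x' y' : [exists s', (x', y', s') \in (x, y, s) |: T]
   = [exists s', (x', y', s') \in T] || ((x' == x) && (y' == y)).
  apply/existsP/orP => [[s']|[/existsP[s' H]|/andP[/eqP-> /eqP->]]].
  - rewrite !inE => /orP[/eqP[-> -> _]|H]; first by right; rewrite !eqxx.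
    by left; apply/existsP; exists s'.
  - by exists s'; rewrite !inE H orbT.
  - by exists s; rewrite !inE eqxx.
have inlE (x1 x2 : X) : (inl x1 == inl x2 :> (X + Y)) = (x1 == x2) by [].
have inrE (y1 y2 : Y) : (inr y1 == inr y2 :> (X + Y)) = (y1 == y2) by [].
case: u v => [x'|y'] [x''|y'']; rewrite /bip_adj ?aux ?inlE ?inrE.
- by rewrite /= andbF.
- by rewrite /= orbF.
- by rewrite /= [(y' == y) && _]andbC.
- by rewrite /= andbF.
Qed.

Lemma is_nctree1 (l : X) (r : Y) Rplus :
  is_nctree [:: l] [:: r] Rplus [set (l, r, r \in Rplus)].
Proof.
rewrite /is_nctree /=; split.
- by move=> t; rewrite !inE => /eqP->.
- rewrite -(finset.setU0 [set _]).
  have adj0 u v : bip_adj (finset.set0 : {set X * Y * bool}) u v = false.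
    by case: u v => [x|y] [x'|y'] //=; apply/existsP => -[s]; rewrite inE.
  (* The single edge is the leaf l added to the tree with the only vertex r. *)
  apply: (@is_tree_leaf _ (pred1 (inr r)) (fun _ _ => false) (inr r) (inl l)) => //=.
  + split=> //; first by exists (inr r); rewrite /= eqxx.
      by move=> u v /eqP-> /eqP->; exact: connect0.
    by case=> [|u [|v c]] // _; rewrite /ucycle /=.
  + by case=> [x|y]; rewrite /= inE /= ?orbF.
  + by move=> u v; rewrite bip_adj1 adj0.
- by move=> t u; rewrite !inE => /eqP-> /eqP-> []; rewrite ltnn.
- by move=> t; rewrite inE => /eqP->.
Qed.

(** The new edge joins the first left vertex to the first right vertex, so it
crosses nothing, and its left end is a leaf. *)
Lemma is_nctree_consl (l : X) L (r : Y) Q Rplus T :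
  L != [::] -> l \notin L -> is_nctree L (r :: Q) Rplus T ->
  is_nctree (l :: L) (r :: Q) Rplus ((l, r, r \in Rplus) |: T).
Proof.
case: L => // l0 L _ lL; rewrite /is_nctree /= => -[TLQ tree nc sgn].
set L0 := l0 :: L in lL TLQ tree nc *; split.
- by move=> t; rewrite 3!inE => /orP[/eqP->/=|/TLQ[]]; rewrite !inE ?eqxx // => -> ->;
    rewrite orbT.
- apply: (is_tree_leaf (a := inr r) (z := inl l) tree) => //=.
  + by rewrite inE eqxx.
  + by case=> [x|y]; rewrite /= inE /= ?orbF.
  + by move=> u v; rewrite bip_adj1.
- have idl t : t \in T -> index t.1.1 (l :: L0) = (index t.1.1 L0).+1.
    move=> /TLQ[tL _] /=; case: eqVneq => // lt.
    by move: lL; rewrite lt tL.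
  move=> t u; rewrite !inE => /orP[/eqP->|tT] /orP[/eqP->|uT] []; rewrite ?ltnn //.
  + by rewrite /= !eqxx.
  + by rewrite /= !eqxx.
  + by rewrite (idl _ tT) (idl _ uT) ltnS => H1 H2; apply: (nc t u).
- by move=> t; rewrite !inE => /orP[/eqP->|/sgn].
Qed.

Lemma is_nctree_consr (l : X) L (r : Y) Q Rplus T :
  Q != [::] -> r \notin Q -> is_nctree (l :: L) Q Rplus T ->
  is_nctree (l :: L) (r :: Q) Rplus ((l, r, r \in Rplus) |: T).
Proof.
case: Q => // r0 Q _ rQ; rewrite /is_nctree /= => -[TLQ tree nc sgn].
set Q0 := r0 :: Q in rQ TLQ tree nc *; split.
- by move=> t; rewrite 3!inE => /orP[/eqP->/=|/TLQ[]]; rewrite !inE ?eqxx // => -> ->;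
    rewrite orbT.
- apply: (is_tree_leaf (a := inl l) (z := inr r) tree) => //=.
  + by rewrite inE eqxx.
  + by case=> [x|y]; rewrite /= inE /= ?orbF.
  + by move=> u v; rewrite bip_adj1; congr (_ || _); rewrite orbC.
- have idr t : t \in T -> index t.1.2 (r :: Q0) = (index t.1.2 Q0).+1.
    move=> /TLQ[_ tQ] /=; case: eqVneq => // rt.
    by move: rQ; rewrite rt tQ.
  move=> t u; rewrite !inE => /orP[/eqP->|tT] /orP[/eqP->|uT] []; rewrite ?ltnn //.
  + by rewrite /= !eqxx.
  + by rewrite /= !eqxx.
  + by rewrite (idr _ tT) (idr _ uT) ltnS => H1 H2; apply: (nc t u).
- by move=> t; rewrite !inE => /orP[/eqP->|/sgn].
Qed.

End Trees.

(** * Weights on noncrossing trees *)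

Section Weights.
Variables (R : realFieldType) (X Y : finType).
Implicit Types (L : seq X) (Q Rplus : seq Y) (T : {set X * Y * bool}).
Implicit Types (w : X * Y * bool -> R).

Definition left_marginal w (x : X) : R := \sum_(t | t.1.1 == x) w t.
Definition right_marginal w (y : Y) : R := \sum_(t | t.1.2 == y) w t.

Definition weighting T w : Prop :=
  (forall t, 0 <= w t) /\ (forall t, t \notin T -> w t = 0).

Lemma left_marginal_out L Q Rplus (T : nctree L Q Rplus) w x :
  (forall t, t \notin nct_edges T -> w t = 0) -> x \notin L -> left_marginal w x = 0.
Proof.
move=> w0 xL; apply: big1 => t /eqP tx; apply: w0; apply: contra xL => /nctree_in[].
by rewrite tx.
Qed.

Lemma right_marginal_out L Q Rplus (T : nctree L Q Rplus) w y :
  (forall t, t \notin nct_edges T -> w t = 0) -> y \notin Q -> right_marginal w y = 0.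
Proof.
move=> w0 yQ; apply: big1 => t /eqP ty; apply: w0; apply: contra yQ => /nctree_in[_].
by rewrite ty.
Qed.

Definition add_weight (t0 : X * Y * bool) (c : R) w t : R :=
  w t + (if t == t0 then c else 0).

Lemma weighting_add T w t0 c :
  0 <= c -> weighting T w -> weighting (t0 |: T) (add_weight t0 c w).
Proof.
move=> c0 [w0 wT]; split=> t; rewrite /add_weight.
  by apply: addr_ge0 => //; case: ifP.
by rewrite !inE negb_or => /andP[/negbTE-> /wT->]; rewrite addr0.
Qed.

Lemma left_marginal_add t0 c w x :
  left_marginal (add_weight t0 c w) x =
  left_marginal w x + (if x == t0.1.1 then c else 0).
Proof.
rewrite /left_marginal big_split /=; congr (_ + _); rewrite -big_mkcondr /=.
case: (eqVneq x t0.1.1) => [->|xt0].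
  rewrite (big_pred1 t0) // => t /=.
  by case: (eqVneq t t0) => [->|]; rewrite ?eqxx ?andbF.
rewrite big_pred0 // => t; case: (eqVneq t t0) => [->|]; rewrite ?andbF //.
by rewrite eq_sym (negbTE xt0).
Qed.

Lemma right_marginal_add t0 c w y :
  right_marginal (add_weight t0 c w) y =
  right_marginal w y + (if y == t0.1.2 then c else 0).
Proof.
rewrite /right_marginal big_split /=; congr (_ + _); rewrite -big_mkcondr /=.
case: (eqVneq y t0.1.2) => [->|yt0].
  rewrite (big_pred1 t0) // => t /=.
  by case: (eqVneq t t0) => [->|]; rewrite ?eqxx ?andbF.
rewrite big_pred0 // => t; case: (eqVneq t t0) => [->|]; rewrite ?andbF //.
by rewrite eq_sym (negbTE yt0).
Qed.

Lemma sum_sub_head (I : eqType) (i : I) (s : seq I) (z : I -> R) (c : R) :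
  uniq (i :: s) ->
  \sum_(j <- i :: s) (z j - (if j == i then c else 0)) = \sum_(j <- i :: s) z j - c.
Proof.
move=> /= /andP[iNs _]; rewrite !big_cons eqxx addrAC; congr (_ + _ - _).
rewrite big_seq [RHS]big_seq; apply: eq_bigr => j js.
by case: eqVneq => [ji|]; rewrite ?subr0 //; rewrite -ji js in iNs.
Qed.

(** The northwest corner rule. The edge joining the first two vertices [l] and
[r] receives the smaller of the amounts [x l] and [y r]; the vertex with that
amount is finished and removed, and the other one keeps the difference. When
one side has a single vertex left, the vertex of the other side is removed: its
amount is then the smaller one, the two totals being equal. *)
Lemma northwest_corner_tree L Q Rplus (x : X -> R) (y : Y -> R) :
  L != [::] -> Q != [::] -> uniq L -> uniq Q ->
  (forall l, 0 <= x l) -> (forall r, 0 <= y r) ->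
  \sum_(l <- L) x l = \sum_(r <- Q) y r ->
  exists (T : nctree L Q Rplus) w, [/\ weighting (nct_edges T) w,
    {in L, left_marginal w =1 x} & {in Q, right_marginal w =1 y}].
Proof.
elim: L Q x y => // l L IHL Q x y _; elim: Q x y => // r Q IHQ x y _.
move=> uL uQ x0 y0; have [lL uL'] := andP uL; have [rQ uQ'] := andP uQ.
have sum_ge0 (I : Type) (s : seq I) (z : I -> R) :
  (forall j, 0 <= z j) -> 0 <= \sum_(j <- s) z j by move=> z0; exact: sumr_ge0.
move=> xy.
have drop_l : L != [::] -> x l <= y r ->
    exists (T : nctree (l :: L) (r :: Q) Rplus) w, [/\ weighting (nct_edges T) w,
    {in l :: L, left_marginal w =1 x} & {in r :: Q, right_marginal w =1 y}].
  move=> LN xl_le; pose y' j := y j - (if j == r then x l else 0).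
  have [||T [w [wT wl wr]]] := IHL (r :: Q) x y' LN isT uL' uQ x0.
  + by move=> j; rewrite /y'; case: eqVneq => [->|_]; rewrite ?subr0 // subr_ge0.
  + by rewrite (sum_sub_head _ _ uQ) -xy big_cons addrAC subrr add0r.
  exists (NCTree (is_nctree_consl LN lL (nct_edgesP T))).
  exists (add_weight (l, r, r \in Rplus) (x l) w); split.
  + exact: weighting_add.
  + move=> j; rewrite left_marginal_add /= inE; case: eqVneq => [-> _|_ /= jL].
      by rewrite (left_marginal_out (T := T)) ?add0r //; case: wT.
    by rewrite addr0 wl.
  + by move=> j jQ; rewrite right_marginal_add /= wr // /y' subrK.
have drop_r : Q != [::] -> y r <= x l ->
    exists (T : nctree (l :: L) (r :: Q) Rplus) w, [/\ weighting (nct_edges T) w,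
    {in l :: L, left_marginal w =1 x} & {in r :: Q, right_marginal w =1 y}].
  move=> QN yr_le; pose x' j := x j - (if j == l then y r else 0).
  have [|||T [w [wT wl wr]]] := IHQ x' y QN uL uQ'.
  + by move=> j; rewrite /x'; case: eqVneq => [->|_]; rewrite ?subr0 // subr_ge0.
  + exact: y0.
  + by rewrite (sum_sub_head _ _ uL) xy big_cons addrAC subrr add0r.
  exists (NCTree (is_nctree_consr QN rQ (nct_edgesP T))).
  exists (add_weight (l, r, r \in Rplus) (y r) w); split.
  + exact: weighting_add.
  + by move=> j jL; rewrite left_marginal_add /= wl // /x' subrK.
  + move=> j; rewrite right_marginal_add /= inE; case: eqVneq => [-> _|_ /= jQ].
      by rewrite (right_marginal_out (T := T)) ?add0r //; case: wT.
    by rewrite addr0 wr.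
have [L0|LN] := eqVneq L [::]; have [Q0|QN] := eqVneq Q [::].
- move: lL rQ uL uQ xy; rewrite {drop_l drop_r uL' uQ' IHL IHQ}L0 {}Q0 => _ _ _ _.
  rewrite !big_seq1 => xy.
  exists (NCTree (is_nctree1 l r Rplus)).
  exists (add_weight (l, r, r \in Rplus) (x l) (fun=> 0)); split.
  + by rewrite -(finset.setU0 (nct_edges _)); apply: weighting_add => //; split.
  + move=> l'; rewrite inE left_marginal_add => /eqP->.
    by rewrite eqxx /left_marginal big1 ?add0r.
  + move=> r'; rewrite inE right_marginal_add => /eqP->.
    by rewrite eqxx /right_marginal big1 ?add0r.
- apply: drop_r => //; move: xy; rewrite {1}L0 !big_cons big_nil addr0 => ->.
  by rewrite lerDl sum_ge0.
- apply: drop_l => //; move: xy; rewrite {1}Q0 !big_cons big_nil addr0 => <-.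
  by rewrite lerDl sum_ge0.
- by have [/drop_l|/ltW/drop_r] := leP (x l) (y r); apply.
Qed.

(** A northwest corner cannot meet both a nonzero weight to its right (same
rows, later columns) and a nonzero weight below it, since two such entries
cross. So the corner contains all the weight of its rows, or all the weight of
its columns. *)
Lemma corner_sum (J : finType) (p q : J -> nat) (w : J -> R) a b :
  (forall t, 0 <= w t) ->
  (forall t u, w t != 0 -> w u != 0 -> ~ ((p t < p u)%N /\ (q u < q t)%N)) ->
  \sum_(t | (p t < a)%N && (q t < b)%N) w t =
  Num.min (\sum_(t | (p t < a)%N) w t) (\sum_(t | (q t < b)%N) w t).
Proof.
move=> w0 nc.
rewrite (bigID (fun t => q t < b)%N (fun t => p t < a)%N) /=.
rewrite (bigID (fun t => p t < a)%N (fun t => q t < b)%N) /=.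
under [X in Num.min _ (X + _)]eq_bigl do rewrite andbC.
set s := (\sum_(t | (p t < a)%N && (q t < b)%N) w t).
set A := \sum_(t | _ && _) w t; set B := \sum_(t | _ && _) w t.
have A0 : 0 <= A by exact: sumr_ge0.
have B0 : 0 <= B by exact: sumr_ge0.
suff [->|->] : A = 0 \/ B = 0.
- by rewrite addr0 min_l // lerDl.
- by rewrite addr0 min_r // lerDl.
have [t /and3P[pt qt wt]|At] := pickP (fun t => [&& (p t < a)%N, ~~ (q t < b)%N & w t != 0]).
  right; apply: big1 => u /andP[qu pu]; apply/eqP/negPn/negP => wu.
  apply: (nc t u wt wu); move: qt pu; rewrite -!leqNgt => qt pu.
  by split; [exact: leq_trans pt pu|exact: leq_trans qu qt].
by left; apply: big1 => t /andP[pt qt]; move: (At t); rewrite pt qt /= => /negPn/eqP.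
Qed.

Lemma sum_ltnS (J : finType) (P : pred J) (q : J -> nat) (w : J -> R) b :
  \sum_(t | P t && (q t < b.+1)%N) w t =
  \sum_(t | P t && (q t < b)%N) w t + \sum_(t | P t && (q t == b)) w t.
Proof.
rewrite (bigID (fun t => q t < b)%N) /=; congr (_ + _); apply: eq_bigl => t.
  by rewrite ltnS -andbA; case: (P t) => //=; case: ltnP => [/ltnW->|]; rewrite ?andbF.
by rewrite ltnS -leqNgt -andbA; congr (_ && _); rewrite eqn_leq.
Qed.

Lemma nctree_noncrossing L Q Rplus (T : nctree L Q Rplus) :
  noncrossing L Q (nct_edges T).
Proof.
case: T => T /= HT; move: HT; rewrite /is_nctree.
by case: ifP => [_ -> t u|_ []//]; rewrite inE.
Qed.

Lemma nctree_edge_inj L Q Rplus (T1 T2 : nctree L Q Rplus) t u :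
  t \in nct_edges T1 -> u \in nct_edges T2 -> t.1 = u.1 -> t = u.
Proof.
have sgn (T : nctree L Q Rplus) v : v \in nct_edges T -> v.2 = (v.1.2 \in Rplus).
  case: T => T /= HT; move: HT; rewrite /is_nctree.
  by case: ifP => [_ ->|_ [_ _ _]]; [rewrite inE|apply].
move=> /sgn t2 /sgn u2 tu; rewrite [t]surjective_pairing [u]surjective_pairing.
by rewrite t2 u2 tu.
Qed.

(** By [corner_sum] the marginals determine the weight of every northwest
corner, hence, by differences, of every cell of the matrix; a cell holds at most
one edge of a tree, the sign being determined by the right end. *)
Lemma nc_weighting_unique L Q Rplus (T1 T2 : nctree L Q Rplus) w1 w2 :
  weighting (nct_edges T1) w1 -> weighting (nct_edges T2) w2 ->
  left_marginal w1 =1 left_marginal w2 -> right_marginal w1 =1 right_marginal w2 ->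
  w1 =1 w2.
Proof.
move=> wT1 wT2 eql eqr.
pose p (t : X * Y * bool) := index t.1.1 L; pose q (t : X * Y * bool) := index t.1.2 Q.
have supp (T : nctree L Q Rplus) w t : weighting (nct_edges T) w ->
    w t != 0 -> t \in nct_edges T.
  by move=> [_ w0]; apply: contraR => /w0->.
have cumL w a : \sum_(t | (p t < a)%N) w t = \sum_(x | (index x L < a)%N) left_marginal w x.
  rewrite (partition_big (fun t => t.1.1) (fun x => index x L < a)%N) //=.
  apply: eq_bigr => x xa; apply: eq_bigl => t; rewrite /p.
  by case: eqVneq => [->|]; rewrite ?andbF ?andbT.
have cumR w b : \sum_(t | (q t < b)%N) w t = \sum_(y | (index y Q < b)%N) right_marginal w y.
  rewrite (partition_big (fun t => t.1.2) (fun y => index y Q < b)%N) //=.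
  apply: eq_bigr => y yb; apply: eq_bigl => t; rewrite /q.
  by case: eqVneq => [->|]; rewrite ?andbF ?andbT.
have corner (T : nctree L Q Rplus) w a b : weighting (nct_edges T) w ->
    \sum_(t | (p t < a)%N && (q t < b)%N) w t =
    Num.min (\sum_(x | (index x L < a)%N) left_marginal w x)
            (\sum_(y | (index y Q < b)%N) right_marginal w y).
  move=> wT; rewrite corner_sum; first by rewrite cumL cumR.
    by case: wT.
  by move=> t u /(supp _ _ _ wT) tT /(supp _ _ _ wT) uT; exact: (nctree_noncrossing tT uT).
have eq_corner a b : \sum_(t | (p t < a)%N && (q t < b)%N) w1 t =
                     \sum_(t | (p t < a)%N && (q t < b)%N) w2 t.
  rewrite (corner _ _ _ _ wT1) (corner _ _ _ _ wT2).
  by congr (Num.min _ _); apply: eq_bigr.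
(* Differences in the column index, then in the row index. *)
have eq_strip a (b : nat) : \sum_(t | (q t == b) && (p t < a)%N) w1 t =
                    \sum_(t | (q t == b) && (p t < a)%N) w2 t.
  under eq_bigl do rewrite andbC; under [RHS]eq_bigl do rewrite andbC.
  by have := eq_corner a b.+1; rewrite !sum_ltnS eq_corner => /addrI.
have eq_cell (a b : nat) : \sum_(t | (q t == b) && (p t == a)) w1 t =
                   \sum_(t | (q t == b) && (p t == a)) w2 t.
  by have := eq_strip a.+1 b; rewrite !sum_ltnS eq_strip => /addrI.
have cell (T T' : nctree L Q Rplus) w t : weighting (nct_edges T) w ->
    t \in nct_edges T' -> \sum_(u | (q u == q t) && (p u == p t)) w u = w t.
  move=> wT tT'; rewrite (bigD1 t) ?eqxx //= big1 ?addr0 // => u.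
  move=> /andP[/andP[/eqP qut /eqP put] ut]; apply/eqP/negPn/negP => /(supp _ _ _ wT) uT.
  have [uL uQ] := nctree_in uT; have [tL tQ] := nctree_in tT'.
  move/eqP: ut; apply; apply: (nctree_edge_inj uT tT').
  rewrite [u.1]surjective_pairing [t.1]surjective_pairing.
  by rewrite (index_inj t.1.1 uL tL put) (index_inj t.1.2 uQ tQ qut).
move=> t.
have [tT1|/(proj2 wT1) w1t] := boolP (t \in nct_edges T1).
  by rewrite -(cell _ _ _ _ wT1 tT1) -(cell _ _ _ _ wT2 tT1).
have [tT2|/(proj2 wT2) ->//] := boolP (t \in nct_edges T2).
by rewrite -(cell _ _ _ _ wT1 tT2) -(cell _ _ _ _ wT2 tT2).
Qed.

(** Uniqueness extends to weights of arbitrary sign on a single tree: the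
positive and the negative part are both supported on the tree. *)
Lemma nc_weighting_inj L Q Rplus (T : nctree L Q Rplus) w :
  (forall t, t \notin nct_edges T -> w t = 0) ->
  (forall x, left_marginal w x = 0) -> (forall y, right_marginal w y = 0) ->
  forall t, w t = 0.
Proof.
move=> wT wl wr t.
pose wp t := Num.max (w t) 0; pose wn t := Num.max (- w t) 0.
have wE u : w u = wp u - wn u.
  rewrite /wp /wn; have [w0|w0] := orP (le_total 0 (w u)).
    by rewrite max_l // max_r ?oppr_le0 // subr0.
  by rewrite max_r // max_l ?oppr_ge0 // sub0r opprK.
have sub_marg (P : pred (X * Y * bool)) :
    \sum_(u | P u) w u = 0 -> \sum_(u | P u) wp u = \sum_(u | P u) wn u.
  by move=> /eqP; under eq_bigr do rewrite wE; rewrite sumrB subr_eq0 => /eqP.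
rewrite wE; apply/eqP; rewrite subr_eq0; apply/eqP.
apply: (@nc_weighting_unique L Q Rplus T T).
- by split=> [u|u /wT wu]; rewrite /wp ?wu ?maxxx // le_max lexx orbT.
- by split=> [u|u /wT wu]; rewrite /wn ?wu ?oppr0 ?maxxx // le_max lexx orbT.
- by move=> x; apply: sub_marg; exact: wl.
- by move=> y; apply: sub_marg; exact: wr.
Qed.

(** Every labelling [b] of the edges of the tree is a sum of two potentials on
the vertices. The edge-vertex incidence matrix [M] has independent rows by
[nc_weighting_inj], so [M z = b] can be solved for [z]. *)
Lemma tree_potential L Q Rplus (T : nctree L Q Rplus) (b : X * Y * bool -> R) :
  exists (c : X -> R) (d : Y -> R),
    forall t, t \in nct_edges T -> c t.1.1 + d t.1.2 = b t.
Proof.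
pose S := nct_edges T.
pose M : 'M[R]_(#|S|, #|X| + #|Y|) :=
  row_mx (\matrix_(k, j) ((enum_val k).1.1 == enum_val j)%:R)
         (\matrix_(k, j) ((enum_val k).1.2 == enum_val j)%:R).
have Mfree : row_free M.
  apply: inj_row_free => v; rewrite mul_mx_row -row_mx0 => /eq_row_mx[vX vY].
  pose w t := \sum_(k | enum_val k == t) v 0 k.
  have wsum (P : pred (X * Y * bool)) :
      \sum_(t | P t) w t = \sum_(k | P (enum_val k)) v 0 k.
    rewrite (exchange_big_dep (fun k => P (enum_val k))) /=; last first.
      by move=> t k Pt /eqP->.
    apply: eq_bigr => k Pk; rewrite (big_pred1 (enum_val k)) // => t /=.
    by rewrite [RHS]eq_sym; case: eqVneq => [<-|]; rewrite ?Pk ?andbF.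
  have w0 : forall t, w t = 0.
    apply: (@nc_weighting_inj L Q Rplus T).
    + move=> t tT; apply: big1 => k /eqP kt.
      by move: tT; rewrite -kt; have := enum_valP k; rewrite /S => ->.
    + move=> x; rewrite /left_marginal wsum.
      have /matrixP/(_ 0 (enum_rank x)) := vX; rewrite [RHS]mxE => v0.
      apply: etrans v0; rewrite mxE [LHS]big_mkcond; apply: eq_bigr => k _; rewrite mxE enum_rankK.
      by case: eqP; rewrite ?mulr1 ?mulr0.
    + move=> y; rewrite /right_marginal wsum.
      have /matrixP/(_ 0 (enum_rank y)) := vY; rewrite [RHS]mxE => v0.
      apply: etrans v0; rewrite mxE [LHS]big_mkcond; apply: eq_bigr => k _; rewrite mxE enum_rankK.
      by case: eqP; rewrite ?mulr1 ?mulr0.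
  apply/rowP => k; rewrite mxE -(w0 (enum_val k)) /w (big_pred1 k) // => k'.
  by rewrite /= (inj_eq enum_val_inj).
pose z : 'cV[R]_(#|X| + #|Y|) := pinvmx M *m \col_k b (enum_val k).
have Mz : M *m z = \col_k b (enum_val k) by rewrite mulmxA mulmxVp // mul1mx.
exists (fun x => usubmx z (enum_rank x) 0), (fun y => dsubmx z (enum_rank y) 0).
move=> t tT; have [k ->] : exists k : 'I_#|S|, t = enum_val k.
  by exists (enum_rank_in tT t); rewrite enum_rankK_in.
move/matrixP: Mz => /(_ k 0); rewrite -[z in LHS]vsubmxK mul_row_col [RHS]mxE => <-.
rewrite [RHS]mxE; congr (_ + _).
- rewrite [RHS]mxE (bigD1 (enum_rank (enum_val k).1.1)) //=.
  rewrite [X in X * _]mxE enum_rankK eqxx mul1r big1 ?addr0 // => j jk; rewrite [X in X * _]mxE; case: eqVneq => [E|]; rewrite ?mul0r //.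
  by rewrite E enum_valK eqxx in jk.
- rewrite [RHS]mxE (bigD1 (enum_rank (enum_val k).1.2)) //=.
  rewrite [X in X * _]mxE enum_rankK eqxx mul1r big1 ?addr0 // => j jk; rewrite [X in X * _]mxE; case: eqVneq => [E|]; rewrite ?mul0r //.
  by rewrite E enum_valK eqxx in jk.
Qed.
End Weights.

Section MarginalSums.
Variables (R : realFieldType) (X Y : finType) (V : lmodType R).

Lemma sum_left_marginal (A : {set X}) (w : X * Y * bool -> R) (F : X -> V) :
  (forall t, t.1.1 \notin A -> w t = 0) ->
  \sum_(x in A) left_marginal w x *: F x = \sum_t w t *: F t.1.1.
Proof.
move=> wA; rewrite [RHS](bigID (fun t => t.1.1 \in A)) /=.
rewrite [X in _ + X]big1 ?addr0 => [|t /wA ->]; last by rewrite scale0r.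
rewrite (partition_big (fun t => t.1.1) (fun x => x \in A)) //=.
apply: eq_bigr => x xA; rewrite scaler_suml; apply: eq_big => [t|t /eqP->//].
by case: eqVneq => [->|]; rewrite ?andbF ?xA.
Qed.

Lemma sum_right_marginal (A : {set Y}) (w : X * Y * bool -> R) (F : Y -> V) :
  (forall t, t.1.2 \notin A -> w t = 0) ->
  \sum_(y in A) right_marginal w y *: F y = \sum_t w t *: F t.1.2.
Proof.
move=> wA; rewrite [RHS](bigID (fun t => t.1.2 \in A)) /=.
rewrite [X in _ + X]big1 ?addr0 => [|t /wA ->]; last by rewrite scale0r.
rewrite (partition_big (fun t => t.1.2) (fun y => y \in A)) //=.
apply: eq_bigr => y yA; rewrite scaler_suml; apply: eq_big => [t|t /eqP->//].
by case: eqVneq => [->|]; rewrite ?andbF ?yA.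
Qed.
End MarginalSums.

(** * Flows around the reduced vertex *)

Section Vertex.
Variables (R : realType) (N : nat) (G : signed_graph [set: 'I_N]) (i : 'I_N).
Hypothesis noloop : forall e : sg_edge G, is_loop e -> ~~ incident i e.

Lemma incoming_not_outgoing (e : sg_edge G) : e \in incoming G i -> e \notin outgoing G i.
Proof.
rewrite !inE => /andP[/negbTE -> /eqP ->] /=.
by rewrite ltnn andbF.
Qed.

(** The strict inequalities in the definition of the outgoing edges leave out
exactly the loops at [i]. *)
Lemma incidentE (e : sg_edge G) :
  incident i e = (e \in incoming G i) || (e \in outgoing G i).
Proof.
have := sg_le e; have := @noloop e; rewrite /is_loop /incident !inE -!val_eqE /=.
by case: (sg_pos e) => /= nl le; move: nl;
  case: (ltngtP (sg_lo e) i); case: (ltngtP (sg_hi e) i) => //= h1 h2; lia.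
Qed.

Lemma sum_edges_at (V : zmodType) (F : sg_edge G -> V) :
  \sum_e F e = \sum_(e | ~~ incident i e) F e
    + (\sum_(e in incoming G i) F e + \sum_(e in outgoing G i) F e).
Proof.
rewrite (bigID (fun e => incident i e)) /= addrC; congr (_ + _).
rewrite (bigID (fun e => e \in incoming G i)) /=; congr (_ + _); apply: eq_bigl => e.
  by rewrite incidentE; case: (e \in incoming G i); rewrite ?andbF.
rewrite incidentE; case: (boolP (e \in incoming G i)) => [/incoming_not_outgoing/negbTE->|_];
  by rewrite ?andbT.
Qed.

Lemma netflow_at (f : {ffun sg_edge G -> R}) :
  netflow f i 0 = \sum_(e in outgoing G i) f e - \sum_(e in incoming G i) f e.
Proof.
rewrite /netflow sum_edges_at !mxE addrA addrC -sumrN; congr (_ + _).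
  rewrite summxE; apply: eq_bigr => e; rewrite /edge_vec !inE => /orP[/andP[/eqP-> ih]|].
    have hi : (i == sg_hi e) = false by apply/negbTE; rewrite -val_eqE neq_ltn ih.
    by case: ifP => _; rewrite !mxE !eqxx hi /= ?mulr1n ?mulr0n ?subr0 ?addr0 mulr1.
  case/and3P=> -> /eqP-> ih.
  have hi : (i == sg_lo e) = false by apply/negbTE; rewrite -val_eqE neq_ltn ih orbT.
  by rewrite !mxE !eqxx hi /= mulr1n mulr0n add0r mulr1.
rewrite !summxE big1 ?add0r => [|e].
  apply: eq_bigr => e ein; have := incoming_lt ein; move: ein.
  rewrite /edge_vec !inE => /andP[/negbTE-> /eqP->] ih.
  have hi : (i == sg_lo e) = false by apply/negbTE; rewrite -val_eqE neq_ltn ih orbT.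
  by rewrite !mxE !eqxx hi /= mulr1n mulr0n sub0r mulrN1.
rewrite negb_or ![_ == i]eq_sym => /andP[/negbTE lo /negbTE hi].
by rewrite /edge_vec; case: ifP; rewrite !mxE lo hi /= ?mulr1n ?mulr0n ?subr0 ?addr0 mulr0.
Qed.

Variables (thetaI thetaO : rel (sg_edge G)).
Notation tree := (reduction_tree i thetaI thetaO).

Lemma mem_left_set e : (e \in left_set i thetaI) = (e \in incoming G i).
Proof. by rewrite mem_sort mem_enum. Qed.

Lemma mem_right_set e : (e \in right_set i thetaO) = (e \in outgoing G i).
Proof. by rewrite mem_sort mem_enum. Qed.

Lemma tree_edge_ends (T : tree) t : t \in nct_edges T ->
  t.1.1 \in incoming G i /\ t.1.2 \in outgoing G i.
Proof. by move=> /nctree_in; rewrite mem_left_set mem_right_set. Qed.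

(** The contributions of [e1] and [e2] at the vertex [i] are opposite and
cancel. *)
Lemma edge_vec_merged (T : tree) (t : {t | t \in nct_edges T}) :
  edge_vec R (G := reduced_graph T) (inr t) =
  edge_vec R (val t).1.1 + edge_vec R (val t).1.2.
Proof.
have [t1 t2] := tree_edge_in t; move: t1 t2.
rewrite /edge_vec /= !inE => /andP[/negbTE -> /eqP ->]; rewrite /merged_ends.
case: eqVneq => [-> _|lo_i /=].
  by case: ifP => _ /=; rewrite addrA subrK.
case/and3P => -> /eqP -> _; rewrite addrACA addNr addr0.
by case: ifP => _ //=; rewrite addrC.
Qed.

(** Extending by zero to all triples gives weights on different trees the same
type. *)
Definition tree_weight (T : tree) (g : {ffun sg_edge (reduced_graph T) -> R})
    (t : sg_edge G * sg_edge G * bool) : R :=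
  if insub t is Some t' then g (inr t') else 0.

Lemma weighting_tree_weight (T : tree) (g : {ffun sg_edge (reduced_graph T) -> R}) :
  (forall d, 0 <= g d) -> weighting (nct_edges T) (tree_weight g).
Proof.
move=> g0; split=> t; rewrite /tree_weight; first by case: insubP.
by move=> tT; rewrite insubN.
Qed.

Lemma sum_tree_weight (T : tree) (g : {ffun sg_edge (reduced_graph T) -> R})
    (P : pred (sg_edge G * sg_edge G * bool)) (V : lmodType R)
    (F : sg_edge G * sg_edge G * bool -> V) :
  \sum_(t : {t | t \in nct_edges T} | P (val t)) g (inr t) *: F (val t) =
  \sum_(t | P t) tree_weight g t *: F t.
Proof.
rewrite [RHS](bigID (fun t => t \in nct_edges T)) /= [X in _ + X]big1 ?addr0; last first.
  by move=> t /andP[_ tT]; rewrite /tree_weight insubN // scale0r.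
under [RHS]eq_bigl do rewrite andbC.
rewrite big_sub_cond; apply: eq_bigr => t _.
by rewrite /tree_weight valK.
Qed.

Lemma flow_lift_nonincident (T : tree) (g : {ffun sg_edge (reduced_graph T) -> R})
    (e : {e : sg_edge G | ~~ incident i e}) : flow_lift g (val e) = g (inl e).
Proof. by rewrite ffunE valK. Qed.

Lemma flow_lift_incoming (T : tree) (g : {ffun sg_edge (reduced_graph T) -> R}) e :
  e \in incoming G i -> flow_lift g e = left_marginal (tree_weight g) e.
Proof.
move=> ein; rewrite ffunE insubF ?ein; last by rewrite incidentE ein.
have := sum_tree_weight g (fun t => t.1.1 == e) (fun=> 1 : R^o).
rewrite /left_marginal => E; apply: etrans (etrans E _); apply: eq_bigr => t _;
  by rewrite [_ *: _]mulr1.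
Qed.

Lemma flow_lift_outgoing (T : tree) (g : {ffun sg_edge (reduced_graph T) -> R}) e :
  e \in outgoing G i -> flow_lift g e = right_marginal (tree_weight g) e.
Proof.
move=> eout; have /negbTE ein : e \notin incoming G i.
  by apply/negP => /incoming_not_outgoing; rewrite eout.
rewrite ffunE insubF ?ein; last by rewrite incidentE eout orbT.
have := sum_tree_weight g (fun t => t.1.2 == e) (fun=> 1 : R^o).
rewrite /left_marginal => E; apply: etrans (etrans E _); apply: eq_bigr => t _;
  by rewrite [_ *: _]mulr1.
Qed.

Lemma sum_tree_marginals (T : tree) (w : sg_edge G * sg_edge G * bool -> R)
    (V : lmodType R) (F1 F2 : sg_edge G -> V) :
  (forall t, t \notin nct_edges T -> w t = 0) ->
  \sum_(e in incoming G i) left_marginal w e *: F1 e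
    + \sum_(e in outgoing G i) right_marginal w e *: F2 e =
  \sum_t w t *: (F1 t.1.1 + F2 t.1.2).
Proof.
move=> wT; rewrite sum_left_marginal; last first.
  by move=> t tin; apply: wT; apply: contra tin => /tree_edge_ends[].
rewrite sum_right_marginal; last first.
  by move=> t tin; apply: wT; apply: contra tin => /tree_edge_ends[].
by rewrite -big_split; apply: eq_bigr => t _; rewrite scalerDr.
Qed.

(** The lifted flow spreads each merged edge over its two halves, whose vectors
add up to that of the merged edge by [edge_vec_merged]. *)
Lemma netflow_flow_lift (T : tree) (g : {ffun sg_edge (reduced_graph T) -> R}) :
  netflow (flow_lift g) = netflow g.
Proof.
rewrite /netflow sum_edges_at big_sumType; congr (_ + _).
  apply: etrans (big_sub (fun e => ~~ incident i e) _) _; apply: eq_bigr => e _.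
  by rewrite flow_lift_nonincident.
transitivity (\sum_(e in incoming G i) left_marginal (tree_weight g) e *: edge_vec R e
  + \sum_(e in outgoing G i) right_marginal (tree_weight g) e *: edge_vec R e).
  by congr (_ + _); apply: eq_bigr => e ee;
    [rewrite flow_lift_incoming | rewrite flow_lift_outgoing].
rewrite (sum_tree_marginals (T := T)); last by move=> t tT; rewrite /tree_weight insubN.
rewrite -(sum_tree_weight g xpredT (fun t => edge_vec R t.1.1 + edge_vec R t.1.2)).
by apply: eq_bigr => t _; rewrite edge_vec_merged.
Qed.

Lemma netflow_reduced_at (T : tree) (g : {ffun sg_edge (reduced_graph T) -> R}) :
  netflow g i 0 = 0.
Proof.
rewrite summxE big1 // => d _; have [] := red_ends d.
rewrite /edge_vec ![_ == i]eq_sym => /negbTE lo /negbTE hi _.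
by case: ifP; rewrite !mxE /= lo hi /= ?subr0 ?addr0 mulr0.
Qed.

Variable a : 'cV[int]_N.
Hypothesis ai0 : a i 0 = 0.

(** This replaces the flows on the reduced graph, which live in a space that
depends on [T], by weights on triples, which can be compared between two trees.
The netflow condition carries over by [netflow_flow_lift]; at [i] it is
automatic, because no edge of the reduced graph meets [i] and [a i 0 = 0]. *)
Lemma reduced_polytopeP (T : tree) (f : {ffun sg_edge G -> R}) :
  reduced_polytope T R a f <->
  flow_polytope G R a f /\ exists w, [/\ weighting (nct_edges T) w,
    {in incoming G i, left_marginal w =1 f} & {in outgoing G i, right_marginal w =1 f}].
Proof.
split.
- case=> g [g0 gv] <-; split.
    split=> [e|v _].
      rewrite ffunE; case: insubP => // _; case: ifP => _; exact: sumr_ge0.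
    rewrite netflow_flow_lift; have [->|vi] := eqVneq v i.
      by rewrite netflow_reduced_at ai0.
    by apply: gv; rewrite !inE.
  exists (tree_weight g); split; first exact: weighting_tree_weight.
    by move=> e ein; rewrite flow_lift_incoming.
  by move=> e eout; rewrite flow_lift_outgoing.
- case=> -[f0 fv] [w [[w0 wT] wl wr]].
  pose g : {ffun sg_edge (reduced_graph T) -> R} := [ffun d : red_edge T =>
    match d with inl e => f (val e) | inr t => w (val t) end].
  have gw : tree_weight g =1 w.
    move=> t; rewrite /tree_weight; case: insubP => [t' _ <-|/wT->//].
    by rewrite ffunE.
  have gf : flow_lift g = f.
    apply/ffunP => e; have [ei|ei] := boolP (incident i e); last first.
      by rewrite (flow_lift_nonincident g (Sub e ei)) ffunE.
    move: ei; rewrite incidentE => /orP[ee|ee].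
      by rewrite flow_lift_incoming // -wl //; apply: eq_bigr => t _.
    by rewrite flow_lift_outgoing // -wr //; apply: eq_bigr => t _.
  exists g => //; split=> [d|v _]; first by rewrite ffunE; case: d.
  by rewrite -netflow_flow_lift gf fv // inE.
Qed.

(** The amounts entering and leaving [i] balance because [a i 0 = 0]. If one
side is empty, this forces the flow to vanish on the other side, in accordance
with the empty tree; otherwise the northwest corner rule applies. *)
Lemma flow_polytope_cover (f : {ffun sg_edge G -> R}) :
  flow_polytope G R a f -> exists T : tree, reduced_polytope T R a f.
Proof.
move=> Pf; have [f0 fv] := Pf.
have bal : \sum_(e <- left_set i thetaI) f e = \sum_(e <- right_set i thetaO) f e.
  rewrite !(perm_big _ (permEl (perm_sort _ _))) !big_enum.
  by have := fv i (finset.in_setT _); rewrite netflow_at ai0 => /eqP; rewrite subr_eq0 => /eqP.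
have [LR0|] := boolP (nilp (left_set i thetaI) || nilp (right_set i thetaO)).
  have T0 : is_nctree (left_set i thetaI) (right_set i thetaO) (right_pos i thetaO) finset.set0.
    by rewrite /is_nctree LR0.
  exists (NCTree T0); apply/reduced_polytopeP; split=> //.
  have sum0 : \sum_(e <- left_set i thetaI) f e = 0 /\ \sum_(e <- right_set i thetaO) f e = 0.
    by case/orP: LR0 => /nilP H; [rewrite -bal|rewrite bal]; rewrite H big_nil.
  have zero (s : seq (sg_edge G)) e : \sum_(e <- s) f e = 0 -> e \in s -> f e = 0.
    move=> /eqP; rewrite psumr_eq0 // => /allP H /H; exact: eqP.
  exists (fun=> 0); split; first by split.
  - move=> e ein; rewrite /left_marginal big1 // (zero (left_set i thetaI)) ?mem_left_set //.
    by case: sum0.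
  - move=> e eout; rewrite /right_marginal big1 // (zero (right_set i thetaO)) ?mem_right_set //.
    by case: sum0.
rewrite negb_or => /andP[/nilP/eqP LN /nilP/eqP RN].
have uL : uniq (left_set i thetaI) by rewrite sort_uniq enum_uniq.
have uR : uniq (right_set i thetaO) by rewrite sort_uniq enum_uniq.
have [T [w [wT wl wr]]] := northwest_corner_tree (right_pos i thetaO) LN RN uL uR f0 f0 bal.
exists T; apply/reduced_polytopeP; split=> //; exists w; split=> //.
- by move=> e ein; apply: wl; rewrite mem_left_set.
- by move=> e eout; apply: wr; rewrite mem_right_set.
Qed.

(** The functional is minus the total weight on the edges of [T] outside [U],
written as a functional on flows by means of the potentials of
[tree_potential]. It is at most 0 on the piece of [T], with equality exactly
when the weights are supported on [U] as well. *)
Lemma reduced_polytope_face (T U : tree) :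
  is_face (reduced_polytope T R a `&` reduced_polytope U R a)%classic
          (reduced_polytope T R a).
Proof.
pose b (t : sg_edge G * sg_edge G * bool) : R := if t \in nct_edges U then 0 else -1.
have [c [d cd]] := tree_potential T b.
pose k : {ffun sg_edge G -> R} := [ffun e => if e \in incoming G i then c e
  else if e \in outgoing G i then d e else 0].
have kE f w : weighting (nct_edges T) w -> {in incoming G i, left_marginal w =1 f} ->
    {in outgoing G i, right_marginal w =1 f} -> \sum_e k e * f e = \sum_t w t * b t.
  move=> [w0 wT] wl wr; rewrite sum_edges_at big1 ?add0r => [|e]; last first.
    by rewrite incidentE negb_or ffunE => /andP[/negbTE-> /negbTE->]; rewrite mul0r.
  transitivity (\sum_(e in incoming G i) left_marginal w e *: (c e : R^o)
    + \sum_(e in outgoing G i) right_marginal w e *: (d e : R^o)).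
    congr (_ + _); apply: eq_bigr => e ee; rewrite ffunE.
      by rewrite ee wl // mulrC.
    rewrite ee ifN ?wr // 1?mulrC //.
    by apply/negP => /incoming_not_outgoing; rewrite ee.
  rewrite (sum_tree_marginals (T := T)) //; apply: eq_bigr => t _.
  by have [tT|/wT->] := boolP (t \in nct_edges T); [rewrite (cd t tT)|rewrite scale0r mul0r].
have wb_le0 w : (forall t, 0 <= w t) -> forall t, w t * b t <= 0.
  move=> w0 t; apply: mulr_ge0_le0 => //; rewrite /b.
  by case: ifP => // _; rewrite lerN10.
exists k, 0; split.
  move=> f /reduced_polytopeP[_ [w [wT wl wr]]]; rewrite (kE _ _ wT wl wr).
  by apply: sumr_le0 => t _; apply: wb_le0; case: wT.
apply/seteqP; split=> f /=.
- case=> fT /reduced_polytopeP[_ [u [uU ul ur]]]; split=> //.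
  move/reduced_polytopeP: fT => [_ [w [wT wl wr]]]; rewrite (kE _ _ wT wl wr).
  have wu : w =1 u.
    apply: (nc_weighting_unique wT uU) => e.
      have [eL|eL] := boolP (e \in left_set i thetaI).
        by move: eL; rewrite mem_left_set => eL; rewrite wl // ul.
      by rewrite (left_marginal_out (proj2 wT)) // (left_marginal_out (proj2 uU)).
    have [eL|eL] := boolP (e \in right_set i thetaO).
      by move: eL; rewrite mem_right_set => eL; rewrite wr // ur.
    by rewrite (right_marginal_out (proj2 wT)) // (right_marginal_out (proj2 uU)).
  apply: big1 => t _; rewrite /b; case: ifPn => [_|tU]; first by rewrite mulr0.
  by rewrite wu (proj2 uU) // mul0r.
- case=> fT H; split=> //; move/reduced_polytopeP: fT => [Pf [w [wT wl wr]]].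
  apply/reduced_polytopeP; split=> //; exists w; split=> //; split; first by case: wT.
  have [w0 wT0] := wT; move: H; rewrite (kE _ _ wT wl wr) => H t tU.
  apply/eqP.
  have /eqP : \sum_t - (w t * b t) = 0 by rewrite sumrN H oppr0.
  rewrite psumr_eq0; last by move=> u _; rewrite oppr_ge0 wb_le0.
  by move/allP/(_ t (mem_index_enum _)); rewrite /b (negbTE tU) /= mulrN1 opprK.
Qed.

End Vertex.

Unset Implicit Arguments.
Set Strict Implicit.

Theorem lemma5p8 (R : realType) (n : nat) (G : signed_graph [set: 'I_n.+1])
    (a : 'cV[int]_n.+1) (i : 'I_n.+1) (thetaI thetaO : rel (sg_edge G))
    (Gconn : sg_connected G)
    (ai0 : a i 0 = 0)
    (noloop : forall e : sg_edge G, is_loop e -> ~~ incident i e)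
    (thetaIP : linear_order_on (incoming G i) thetaI)
    (thetaOP : linear_order_on (outgoing G i) thetaO) :
  subdivides_as (flow_polytope G R a)
    (fun T : reduction_tree i thetaI thetaO => reduced_polytope T R a).
Proof.
split.
- apply/seteqP; split=> f.
    by case/(flow_polytope_cover noloop thetaI thetaO ai0) => T fT; exists T.
  by case=> T _ /(reduced_polytopeP noloop ai0)[].
- move=> T U; split; first exact: reduced_polytope_face.
  by rewrite classical_sets.setIC; exact: reduced_polytope_face.
Qed.
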